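(* Let $f:\mathbb R^n\to\mathbb R^n$ be a polynomial vector field with $p:=\deg(f)\ge 2$ and $f(0)=0$, and let $h:=p-1$. Let $x_0\in\mathbb R^n$, let $T>0$ be such that $[0,T]$ is contained in the interval of definition of the solution $x(t;x_0)$ of $\dot x=f(x)$, $x(0)=x_0$, and let $R<+\infty$ satisfy $\sup_{t\in[0,T]}\|x(t;x_0)\|_\infty\le R$; put $R_+:=\max(R,1)$. Let $v$, $\epsilon_D$, $C_2$, $\Theta$, $k_D$ be as defined in the context and let $\rho(T):=hC_2\Theta(T)$. Assume $\rho(T)<1$. Then, for all $D\ge1$, $$\sup_{t\in[0,T]}\epsilon_D(t;x_0)\le K_1\,\gamma_1^{\,k_D},$$ where $$\gamma_1:=R^h\rho(T),\qquad K_1:=\frac{\|v\|_1\,\rho(T)\,R^2R_+^{2h-2}}{1-\rho(T)}.$$ In particular, if $\gamma_1<1$, then $\sup_{t\in[0,T]}\epsilon_D(t;x_0)\to0$ as $D\to+\infty$.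
   Context: Here $\deg(f)=\max_k\deg(f_k)$ (total degree). Write $f(x)=F_1x+f_{\ge2}(x)$, where $F_1=Df(0)$ is the Jacobian of $f$ at $0$ and $(f_{\ge2})_i(x)=\sum_{2\le|\gamma|\le p}c_{i\gamma}x^\gamma$ ($\gamma\in\mathbb N^n$, $|\gamma|=\sum_i\gamma_i$). Set $C_2:=\max_{1\le i\le n}\sum_{2\le|\gamma|\le p}|c_{i\gamma}|$. For a $k\times k$ real matrix $U$, $\mu_\infty(U):=\max_{1\le i\le k}\big(U_{ii}+\sum_{\ell\ne i}|U_{i\ell}|\big)$ (logarithmic norm). Set $\mu_1:=\mu_\infty(F_1)$, $\mu_1^+:=\max(\mu_1,0)$, $\mu_1^-:=\min(\mu_1,0)$, and for $t\in[0,T]$ $$\Theta(t):=\int_0^t e^{(\mu_1^-+h\mu_1^+)s}\,ds .$$ Carleman truncation of degree $D\ge1$: let $\alpha=(\alpha_1,\dots,\alpha_M)^T$ be the vector of all non-constant monomials $x^\beta$ in $x=(x_1,\dots,x_n)$ of total degree at most $D$ (degrees $1,\dots,D$), ordered by nondecreasing total degree. With the Lie derivative $\mathcal L_f(u)=\sum_{j=1}^n\frac{\partial u}{\partial x_j}f_j$ applied componentwise, there are unique constant matrices $A\in\mathbb R^{M\times M}$ and $B$ such that $\mathcal L_f(\alpha)=A\alpha+B\psi$, where $\psi$ is the vector of the monomials of degrees $D+1,\dots,D+p-1$. The observable is $g(x)=v^T\alpha(x)$ with $v\in\mathbb R^M$ supported on degree $1$, meaning $v_j\neq0$ only if $\deg(\alpha_j)=1$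 (so $g$ is a linear form, the same for all $D$, $v$ being padded with zeros). Set $z_D(t;z_0):=e^{At}\alpha(x_0)$ and $$\epsilon_D(t;x_0):=|v^T\alpha(x(t;x_0))-v^Tz_D(t;z_0)|.$$ Support gap: $k_D:=\lceil (D-h)/h\rceil$, equivalently $k_D+1=\lceil D/h\rceil$. $\|v\|_1=\sum_j|v_j|$. *)

(* Defs.v *)
(* MathComp-Analysis, with polynomials from multinomials: its notations clash
   with those of MathComp-Analysis, so only its constants are imported. *)
From HB Require Import structures.
From mathcomp Require Import all_boot all_order all_algebra.
From mathcomp Require Import -(notations) mpoly.
From mathcomp Require Import all_classical all_reals all_analysis.
From mathcomp Require Import zify.

Set Implicit Arguments.
Unset Strict Implicit.
Unset Printing Implicit Defensive.

Import Order.TTheory GRing.Theory Num.Theory.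
Import numFieldNormedType.Exports.

Local Open Scope classical_set_scope.
Local Open Scope ring_scope.

Section PolynomialVectorFields.
Variables (R : realType) (n : nat).
Implicit Types (u : mpoly n R) (f : 'cV[mpoly n R]_n) (y : 'cV[R]_n).

(* [mmeasure mdeg] is one plus the total degree, and 0 on the zero polynomial. *)
Definition tdeg u : nat := (mmeasure mdeg u).-1.

Definition vdeg f : nat := \max_(k < n) tdeg (f k 0%R).

Definition evalv (k : nat) y (w : 'cV[mpoly n R]_k) : 'cV[R]_k :=
  map_mx (meval (fun i => y i 0)) w.

Definition jacobian0 f : 'M[R]_n :=
  \matrix_(i, j) meval (fun=> 0) (mderiv j (f i 0)).

Definition C2 f : R :=
  \big[Num.max/0]_(i < n)
    \sum_(g : bmultinom n (vdeg f).+1 | (2 <= mdeg g)%N) `|mcoeff g (f i 0)|.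

(* The entries may be negative, so there is no neutral element to start an
   iterated maximum from; for k > 0 the supremum is that of a nonempty finite
   set, hence a maximum. *)
Definition mu_oo (k : nat) (U : 'M[R]_k) : R :=
  sup [set U i i + \sum_(l < k | l != i) `|U i l| | i in [set: 'I_k]].

Definition Theta f (t : R) : R :=
  let h := (vdeg f).-1 in
  let mu1 := mu_oo (jacobian0 f) in
  (\int[lebesgue_measure]_(s in `[0, t])
     expR ((Num.min mu1 0 + h%:R * Num.max mu1 0) * s))%R.

Definition rho f (t : R) : R := (vdeg f).-1%:R * C2 f * Theta f t.

(* Solutions are unique, so the restriction to J of the maximal solution is the
   only x, up to its values outside J, that satisfies this. *)
Definition is_solution f (x0 : 'cV[R]_n) (J : set R) (x : R -> 'cV[R]_n) : Prop :=
  [/\ open J, is_interval J, J 0, x 0 = x0 &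
      forall t : R, J t -> is_derive t 1 x (evalv (x t) f)].

End PolynomialVectorFields.

(* The exponents of total degree a, a + 1, ..., b, in this order of degrees; the
   order inside one degree is that of [enum]. *)
Definition monomials (n a b : nat) : seq (multinom n) :=
  flatten [seq [seq bmnm g | g : bmultinom n d.+1 <- enum {: bmultinom n d.+1}
                           & mdeg g == d]
          | d <- iota a (b.+1 - a)].

Definition nmon (n a b : nat) : nat := size (monomials n a b).

Section Carleman.
Variables (R : realType) (n : nat).
Implicit Types (f : 'cV[mpoly n R]_n) (D : nat).

Definition monv (a b : nat) : 'cV[mpoly n R]_(nmon n a b) :=
  \col_j mpolyX R (nth mnm0 (monomials n a b) j).

Definition alpha D : 'cV[mpoly n R]_(nmon n 1 D) := monv 1 D.

Definition Lie f (u : mpoly n R) : mpoly n R :=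
  \sum_(j < n) mderiv j u * f j 0.

Definition carleman_matrices f D
    (A : 'M[R]_(nmon n 1 D))
    (B : 'M[R]_(nmon n 1 D, nmon n D.+1 (D + (vdeg f).-1))) : Prop :=
  map_mx (Lie f) (alpha D) =
    map_mx (@mpolyC n R) A *m alpha D
    + map_mx (@mpolyC n R) B *m monv D.+1 (D + (vdeg f).-1).

Definition supported_deg1 D (v : 'cV[R]_(nmon n 1 D)) : Prop :=
  forall j, v j 0 != 0 -> tdeg (alpha D j 0) = 1%N.

Definition observable D (v : 'cV[R]_(nmon n 1 D)) (y : 'cV[R]_n) : R :=
  (v^T *m evalv y (alpha D)) 0 0.

End Carleman.

Section Truncation.
Variable R : realType.

Definition norm1 (k : nat) (v : 'cV[R]_k) : R := \sum_j `|v j 0|.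

Definition expmx (k : nat) (U : 'M[R]_k) : 'M[R]_k :=
  limn (series (fun i : nat => (i`!%:R)^-1 *: U ^+ i)).

Definition zD n D (A : 'M[R]_(nmon n 1 D)) (x0 : 'cV[R]_n) (t : R) :
    'cV[R]_(nmon n 1 D) :=
  expmx (t *: A) *m evalv x0 (alpha R n D).

Definition eps n D (A : 'M[R]_(nmon n 1 D)) (v : 'cV[R]_(nmon n 1 D))
    (x : R -> 'cV[R]_n) (x0 : 'cV[R]_n) (t : R) : R :=
  `|observable v (x t) - (v^T *m zD A x0 t) 0 0|.

Definition kgap (h D : nat) : int := Num.ceil ((D%:R - h%:R) / h%:R : R).

End Truncation.

Lemma mem_monomials n a b (m : multinom n) :
  (m \in monomials n a b) = (a <= mdeg m <= b)%N.
Proof.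
apply/flatten_mapP/idP => [[d]|/andP[am mb]].
  rewrite mem_iota => hd /mapP[g]; rewrite mem_filter => /andP[/eqP gd _] ->.
  lia.
exists (mdeg m); first by rewrite mem_iota; lia.
by apply/mapP; exists (BMultinom (ltnSn (mdeg m))); rewrite // mem_filter mem_enum eqxx.
Qed.

Lemma uniq_monomials n a b : uniq (monomials n a b).
Proof.
rewrite /monomials; move: (b.+1 - a)%N => k; elim: k a => //= k IH a.
rewrite cat_uniq IH andbT (map_inj_uniq val_inj) filter_uniq ?enum_uniq //=.
apply/hasPn => m /flatten_mapP[d]; rewrite mem_iota => hd /mapP[g].
rewrite mem_filter => /andP[/eqP gd _ ->]; apply/negP => /mapP[g'].
rewrite mem_filter => /andP[/eqP gd' _] e; have := congr1 mdeg e; lia.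
Qed.

Lemma monomials_cat n a b c : (a <= b.+1)%N -> (b <= c)%N ->
  monomials n a c = monomials n a b ++ monomials n b.+1 c.
Proof.
move=> ab bc; rewrite /monomials -flatten_cat -map_cat; congr (flatten (map _ _)).
by have -> : (c.+1 - a = (b.+1 - a) + (c.+1 - b.+1))%N by [lia]; rewrite iotaD subnKC.
Qed.

Lemma combE (R : realType) n a b k (C : 'M[R]_(k, nmon n a b)) i m :
  mcoeff m ((map_mx (@mpolyC n R) C *m monv R n a b) i 0) =
  \sum_(j < nmon n a b) C i j * (nth mnm0 (monomials n a b) j == m)%:R.
Proof.
rewrite mxE raddf_sum; apply: eq_bigr => j _ /=.
by rewrite !mxE mcoeffCM mcoeffX.
Qed.

Lemma combE_coef (R : realType) n a b k (C : 'M[R]_(k, nmon n a b)) i (j : 'I_(nmon n a b)) :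
  mcoeff (nth mnm0 (monomials n a b) j) ((map_mx (@mpolyC n R) C *m monv R n a b) i 0) = C i j.
Proof.
rewrite combE (bigD1 j) //= eqxx mulr1 big1 ?addr0 // => l lj.
by rewrite nth_uniq ?uniq_monomials // (inj_eq val_inj) (negbTE lj) mulr0.
Qed.

Lemma combE_out (R : realType) n a b k (C : 'M[R]_(k, nmon n a b)) i m :
  m \notin monomials n a b ->
  mcoeff m ((map_mx (@mpolyC n R) C *m monv R n a b) i 0) = 0.
Proof.
move=> mN; rewrite combE big1 // => j _; case: eqP => [e|]; last by rewrite mulr0.
by move: mN; rewrite -e mem_nth.
Qed.

Lemma Lie_supp (R : realType) n (f : 'cV[mpoly n R]_n) (g m : multinom n) :
  evalv 0 f = 0 -> mcoeff m (Lie f (mpolyX R g)) != 0 ->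
  (mdeg g <= mdeg m <= mdeg g + (vdeg f).-1)%N.
Proof.
move=> f0; rewrite /Lie raddf_sum => /eqP nz.
have [j] : exists j, mcoeff m (mderiv j (mpolyX R g) * f j 0) != 0.
  apply/existsP; apply: contra_notT nz => /existsPn h; apply: big1 => j _.
  by apply/eqP; have := h j; rewrite negbK.
rewrite mderivX -scalerAl mcoeffZ mulf_eq0 negb_or pnatr_eq0 => /andP[gj].
rewrite -mcoeff_msupp => /msuppM_le/allpairsP[[m1 m2] /= [+ hm2 ->]].
rewrite msuppX inE => /eqP ->.
have hm2' := hm2.
rewrite mcoeff_msupp in hm2'.
have m2_gt0 : (0 < mdeg m2)%N.
  rewrite lt0n mdeg_eq0; apply: contraNneq hm2' => ->.
  have := congr1 (fun z : 'cV[R]_n => z j 0) f0.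
  rewrite /evalv !mxE => <-; apply/eqP; rewrite [in LHS](mpolyE (f j 0)) mevalE raddf_sum.
  apply: eq_bigr => k _ /=; rewrite mcoeffZ mcoeffX; congr (_ * _).
  case: eqP => [->|/eqP kn]; first by rewrite big1 // => i _; rewrite mnm0E expr0.
  have /existsP[i ki] : [exists i, k i != 0%N].
    apply: contraR kn => /existsPn h; apply/eqP/mnmP => i.
    by apply/eqP; have := h i; rewrite negbK mnm0E.
  by rewrite (bigD1 i) //= mxE expr0n (negbTE ki) mul0r.
have m2_le : (mdeg m2 <= vdeg f)%N.
  apply: leq_trans (leq_bigmax (F := fun k => tdeg (f k 0)) j).
  by rewrite /tdeg; move: (msize_mdeg_lt hm2); case: (mmeasure _ _).
have e : g = mnm_add (mnm_sub g (mnm1 j)) (mnm1 j) by rewrite submK // lep1mP.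
have := congr1 (@mdeg n) e; rewrite !mdegD mdeg1 => ->.
move: m2_gt0 m2_le; move: (mdeg _) (mdeg m2) (vdeg f) => a b c; lia.
Qed.

Lemma carleman_matrices_ex_uniq (R : realType) n (f : 'cV[mpoly n R]_n) D :
  evalv 0 f = 0 ->
  exists! AB : 'M[R]_(nmon n 1 D) *
      'M[R]_(nmon n 1 D, nmon n D.+1 (D + (vdeg f).-1)),
    carleman_matrices AB.1 AB.2.
Proof.
move=> f0.
set E := (D + _)%N.
pose L i m := mcoeff m (Lie f (alpha R n D i 0)).
pose C a b : 'M[R]_(nmon n 1 D, nmon n a b) :=
  \matrix_(i, j) L i (nth mnm0 (monomials n a b) j).
have degN (i : 'I_(nmon n 1 D)) : (1 <= mdeg (nth mnm0 (monomials n 1 D) i) <= D)%N.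
  by rewrite -mem_monomials mem_nth.
have low m : m \in monomials n 1 D -> m \notin monomials n D.+1 E.
  by rewrite !mem_monomials; lia.
have key (A : 'M[R]_(nmon n 1 D)) (B : 'M[R]_(nmon n 1 D, nmon n D.+1 E)) i m :
    mcoeff m ((map_mx (@mpolyC n R) A *m alpha R n D
       + map_mx (@mpolyC n R) B *m monv R n D.+1 E) i 0) =
    mcoeff m ((map_mx (@mpolyC n R) A *m monv R n 1 D) i 0)
    + mcoeff m ((map_mx (@mpolyC n R) B *m monv R n D.+1 E) i 0).
  by rewrite mxE mcoeffD.
exists (C 1%N D, C D.+1 E); split=> [|[A B] /= AB].
  apply/colP => i; apply/mpolyP => m; rewrite key mxE -/(L i m).
  have [ml|ml] := boolP (m \in monomials n 1 D).
    rewrite [X in _ + X]combE_out ?low // addr0.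
    have lt_m : (index m (monomials n 1 D) < nmon n 1 D)%N by rewrite index_mem.
    have := combE_coef (C 1%N D) i (Ordinal lt_m).
    by rewrite [in RHS]mxE nth_index //= => ->.
  rewrite combE_out // add0r.
  have [mh|mh] := boolP (m \in monomials n D.+1 E).
    have lt_m : (index m (monomials n D.+1 E) < nmon n D.+1 E)%N by rewrite index_mem.
    have := combE_coef (C D.+1 E) i (Ordinal lt_m).
    by rewrite /alpha [in RHS]mxE nth_index //.
  rewrite combE_out //; apply/eqP; apply: contraNT mh => h.
  move: ml; rewrite !mem_monomials.
  have := degN i; move: h; rewrite /L /alpha /monv mxE => /(Lie_supp f0).
  rewrite /E; lia.
have ABE i m : L i m = mcoeff m ((map_mx (@mpolyC n R) A *m monv R n 1 D) i 0)
    + mcoeff m ((map_mx (@mpolyC n R) B *m monv R n D.+1 E) i 0).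
  rewrite -key; have := congr1 (fun z : 'cV[mpoly n R]__ => mcoeff m (z i 0)) AB.
  by rewrite [in X in X -> _]mxE.
have -> : C 1%N D = A.
  apply/matrixP => i j; rewrite mxE ABE.
  by rewrite combE_coef [X in _ + X]combE_out ?addr0 // low // mem_nth.
have -> // : C D.+1 E = B.
apply/matrixP => i j; rewrite mxE ABE combE_coef combE_out ?add0r //.
by apply: contraL (mem_nth mnm0 (ltn_ord j)) => /low.
Qed.

(* Main.v *)
Require Import Defs.
From HB Require Import structures.
From mathcomp Require Import all_boot all_order all_algebra.
From mathcomp Require Import -(notations) mpoly.
From mathcomp Require Import all_classical all_reals all_analysis.
From mathcomp Require Import zify ring lra.

Set Implicit Arguments.
Unset Strict Implicit.
Unset Printing Implicit Defensive.

Import Order.TTheory GRing.Theory Num.Theory.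
Import numFieldNormedType.Exports.

Local Open Scope classical_set_scope.
Local Open Scope ring_scope.

(** Why the bound holds.  The error of the monomial [x^m] of degree [d <= D]
    obeys a linear equation whose coefficients are those of the Lie derivative
    of [x^m]: the linear part of the field maps degree [d] to itself, with
    logarithmic norm at most [d mu_1], and the nonlinear part feeds in errors
    of degrees [d+1, ..., d+h] with total weight at most [d C_2].  Above the
    degree [D] nothing is subtracted, so there the error is the monomial itself
    along the trajectory.  Errors at degree 1 thus come from the truncated
    degrees through a number [j] of jumps, and it takes at least [D/h] jumps to
    exceed [D].

    After [k] jumps from degree 1 the degree lies between [1+k] and [1+kh].
    Hence [d mu_1 <= (k+1) a] with [a = mu_1^- + h mu_1^+], and
    [d C_2 <= (k+1) C] with [C = h C_2]: both bounds depend on [k] alone.  So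
    the errors are dominated by functions [b_k] of the jump count, where [M]
    bounds the truncated monomials:

      [b_k' = (k+1) (a b_k + C (b_(k+1) + M [k+1 >= D/h]))], [b_k(0) = 0].

    The degree does not determine the number of jumps, so one monomial is
    compared with [b_k] for several [k] at once, and a jump always leads from
    [k] to [k+1].  The domination is [err_le_chain], an instance of the maximum
    principle [max_principle].

    The first majorant is explicit.  The adjoint of the chain, started at
    [k = 0], is solved by [e^(a t) (C Theta(t))^k], because
    [e^(a t) = 1 + a Theta(t)]; pairing it with [b] gives
    [b_0 = M sum_j (C Theta)^j] over [D/h <= j <= D] ([chain_first]), at most
    the tail [M rho^(k_D + 1) / (1 - rho)] of a geometric series.  Finally the
    truncated degrees are between [h k_D + 2] and [h k_D + 2h], which gives the
    powers of [R] and [R_+]. *)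

(** * A maximum principle for finite families *)

(** One-sided: the maximum may be at the right end of the interval, where the
    derivative need not vanish. *)
Lemma derive_ge0_at_max (R : realType) (f : R -> R) (a c df : R) :
  a < c -> is_derive c 1 f df ->
  (forall t, a <= t <= c -> f t <= f c) -> 0 <= df.
Proof.
move=> ac fd fmax; have [dfc <-] := fd.
rewrite ['D_1 f c]cvg_at_leftE; last exact: dfc.
apply: limr_ge.
  rewrite -(cvg_at_leftE (fun h => h^-1 *: ((f \o shift c) _ - f c))) //.
  apply: cvg_trans dfc; apply: cvg_app.
  move=> A [e egt0 Ae]; exists e => // x xe xgt0; apply: Ae => //.
  exact/ltr0_neq0.
near=> h; apply: mulr_le0.
  by rewrite invr_le0; apply: ltW; near: h; exists 1 => /=.
rewrite subr_le0 [_%:A]mulr1; apply: fmax; near: h.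
exists (c - a); first by rewrite /= subr_gt0.
move=> h; rewrite /= distrC subr0 => /ltr_normlP[h1 _] h0.
lra.
Unshelve. all: by end_near. Qed.

(** The differential inequality is required only at those [t] and [i] where
    [u i t] is positive and is the largest member of the family at time [t].
    After multiplication by [e^(-(L+1) t)], a positive maximum over all [i] and
    all times would be at such a place, at a positive time, with a negative
    derivative, which is impossible. *)
Lemma max_principle (R : realType) (I : finType) (P : pred I)
    (u du : I -> R -> R) (T L : R) :
  (forall i t, P i -> 0 <= t <= T -> is_derive t 1 (u i) (du i t)) ->
  (forall i, P i -> u i 0 <= 0) ->
  (forall i t, P i -> 0 <= t <= T -> 0 < u i t ->
     (forall j, P j -> u j t <= u i t) -> du i t <= L * u i t) ->
  forall i t, P i -> 0 <= t <= T -> u i t <= 0.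
Proof.
move=> ud u0 uq i t Pi tT; rewrite leNgt; apply/negP => uit.
pose w j s := expR (- (L + 1) * s) * u j s.
have wd j s : P j -> 0 <= s <= T ->
    is_derive s 1 (w j) (expR (- (L + 1) * s) * (du j s - (L + 1) * u j s)).
  move=> Pj sT; have ujd := ud j s Pj sT.
  have -> : w j = (expR \o ( *%R (- (L + 1)))) * u j by [].
  apply: is_derive_eq; rewrite /= /GRing.scale /=; ring.
have mx j : exists s, P j -> (0 <= s <= T) /\ forall r, 0 <= r <= T -> w j r <= w j s.
  case: (boolP (P j)) => Pj; last by exists 0 => /negP.
  have T0 : 0 <= T by case/andP: tT; exact: le_trans.
  have [|c] := @EVT_max R (w j) 0 T T0.
    apply: derivable_within_continuous => s; rewrite in_itv/= => sT.
    by have [] := wd j s Pj sT.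
  rewrite in_itv /= => cT cmax; exists c; move=> _; split; first exact: cT.
  by move=> r rT; apply: cmax; rewrite in_itv.
have [c cP] := choice mx.
case: (arg_maxP (fun j => w j (c j)) Pi) => j Pj jmax.
have [cT cmax] := cP j Pj.
have wj0 : 0 < w j (c j).
  apply: (@lt_le_trans _ _ (w i t)); first by rewrite mulr_gt0 ?expR_gt0.
  by apply: (le_trans _ (jmax i Pi)); apply: (cP i Pi).2.
have uj0 : 0 < u j (c j) by move: wj0; rewrite pmulr_rgt0 ?expR_gt0.
have c0 : 0 < c j.
  rewrite lt_neqAle (andP cT).1 andbT; apply/negP => /eqP e.
  by move: uj0; rewrite -e ltNge u0.
have := derive_ge0_at_max c0 (wd j _ Pj cT).
rewrite leNgt pmulr_rlt0 ?expR_gt0 // => H.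
have : du j (c j) <= L * u j (c j).
  apply: uq => // k Pk; rewrite -(ler_pM2l (expR_gt0 (- (L + 1) * c j))).
  by apply: le_trans (jmax k Pk); apply: (cP k Pk).2.
suff /negP : ~~ (du j (c j) - (L + 1) * u j (c j) < 0) by move=> + ?; apply; lra.
apply: H => s sc; apply: cmax.
by move: sc cT => /andP[-> /le_trans h] /andP[_ /h].
Qed.

(** * The matrix exponential solves its linear equation *)

Section MatrixExponential.
Variable R : realType.

(** [expmx] is a limit in the space of matrices, while the differentiation of
    power series is available for real series only: this passes to entries. *)
Lemma cvg_mx_entries (m n : nat) (T : Type) (F : set_system T) (FF : Filter F)
    (f : T -> 'M[R]_(m, n)) (l : 'M[R]_(m, n)) :
  (forall i j, f x i j @[x --> F] --> l i j) -> f x @[x --> F] --> l.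
Proof.
move=> fl; apply/cvgrPdist_le => /= e e0; near=> x.
rewrite /Num.Def.normr/= mx_normrE (bigmax_le _ (ltW e0))//= => i _.
rewrite !mxE/=.
move: i; near: x; apply: filter_forall => /= i.
exact: ((cvgrPdist_le _ _).1 (fl i.1 i.2)).
Unshelve. all: by end_near. Qed.

Variable k : nat.
Implicit Types (U : 'M[R]_k) (z : 'cV[R]_k).

Definition exp_entry U (i j : 'I_k) (m : nat) : R := (m`!%:R)^-1 * (U ^+ m) i j.

Lemma expr_entry_le U m i j :
  `|(U ^+ m) i j| <= (\sum_i \sum_j `|U i j|) ^+ m.
Proof.
elim: m i j => [|m IH] i j.
  by rewrite !expr0 [X in `|X|]mxE; case: eqP => //= _; rewrite ?normr1 ?normr0.
rewrite !exprS -mulmxE mxE (le_trans (ler_norm_sum _ _ _)) //.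
have S0 i' : 0 <= \sum_j `|U i' j| by apply: sumr_ge0.
apply: (@le_trans _ _ (\sum_l `|U i l| * (\sum_i \sum_j `|U i j|) ^+ m)).
  by apply: ler_sum => l _; rewrite normrM ler_wpM2l.
rewrite -mulr_suml ler_wpM2r ?exprn_ge0 ?sumr_ge0 //.
by rewrite [leRHS](bigD1 i) //= lerDl sumr_ge0.
Qed.

Lemma is_cvg_exp_entry U i j t : cvgn (pseries (exp_entry U i j) t).
Proof.
set K := \sum_i \sum_j `|U i j|.
have K0 : 0 <= K by apply: sumr_ge0 => ? _; apply: sumr_ge0.
apply: normed_cvg.
apply: (series_le_cvg _ _ _ (is_cvg_series_exp_coeff (K * `|t|))) => m //=.
  by rewrite divr_ge0 // exprn_ge0 // mulr_ge0.
rewrite normrM normrX /exp_entry normrM ger0_norm ?invr_ge0 //.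
rewrite /exp_coeff /= exprMn [leRHS]mulrC mulrA ler_wpM2r ?exprn_ge0 //.
by rewrite ler_wpM2l ?invr_ge0 // expr_entry_le.
Qed.

Lemma pseries_diffs_exp_entry U i j :
  pseries_diffs (exp_entry U i j) = fun m => \sum_l U i l * exp_entry U l j m.
Proof.
apply/funext => m; rewrite /pseries_diffs /exp_entry exprS -mulmxE mxE.
rewrite mulrA mulr_sumr; apply: eq_bigr => l _.
have f0 : m`!%:R != 0 :> R by rewrite pnatr_eq0 -lt0n fact_gt0.
by rewrite factS natrM; field; rewrite f0 addrC natr1 pnatr_eq0.
Qed.

Lemma pseries_lincomb (I : finType) (a : I -> R) (c : I -> nat -> R) t :
  (forall l, cvgn (pseries (c l) t)) ->
  pseries (fun m => \sum_l a l * c l m) t @ \oo -->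
    \sum_l a l * limn (pseries (c l) t).
Proof.
move=> cc.
have -> : pseries (fun m => \sum_l a l * c l m) t =
    fun N => \sum_l a l * pseries (c l) t N.
  apply/funext => N; rewrite /pseries /series /=.
  under eq_bigr do rewrite mulr_suml.
  rewrite exchange_big /=; apply: eq_bigr => l _; rewrite mulr_sumr.
  by apply: eq_bigr => m _; rewrite mulrA.
apply: cvg_big => [|l _]; first exact: add_continuous.
apply: cvgMl_tmp; exact: cc.
Qed.

Lemma exprZ_mx U t m : (t *: U) ^+ m = t ^+ m *: U ^+ m.
Proof.
elim: m => [|m IH]; first by rewrite !expr0 scale1r.
by rewrite !exprS IH -!mulmxE -scalemxAl -scalemxAr scalerA.
Qed.

Lemma expmx_entry U t i j : expmx (t *: U) i j = limn (pseries (exp_entry U i j) t).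
Proof.
have -> : expmx (t *: U) = \matrix_(i, j) limn (pseries (exp_entry U i j) t).
  apply: cvg_lim => //; apply: cvg_mx_entries => i' j'; rewrite mxE.
  rewrite (_ : (fun x => _) = pseries (exp_entry U i' j') t); last first.
    apply/funext => N; rewrite /pseries /series /= summxE; apply: eq_bigr => m _.
    rewrite mxE /exp_entry exprZ_mx mxE; ring.
  exact: is_cvg_exp_entry.
by rewrite mxE.
Qed.

Lemma expmx0 : expmx (0 : 'M[R]_k) = 1%:M.
Proof.
apply/matrixP => i j; rewrite -(scale0r (0 : 'M[R]_k)) expmx_entry.
apply: cvg_lim => //; rewrite -cvg_shiftS /=.
apply: cvg_near_cst; near=> N.
rewrite /pseries /series /= big_nat_recl // big1 => [|m _].
  by rewrite /exp_entry !expr0 fact0 invr1 mul1r mulr1 addr0.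
by rewrite expr0n /= mulr0.
Unshelve. all: by end_near. Qed.

Lemma is_derive_expmx U i j (t : R) :
  is_derive t 1 (fun t : R => expmx (t *: U) i j) ((U *m expmx (t *: U)) i j).
Proof.
have -> : (fun t : R => expmx (t *: U) i j) = fun t => limn (pseries (exp_entry U i j) t).
  by apply/funext => s; rewrite expmx_entry.
have cd i' j' s : pseries (pseries_diffs (exp_entry U i' j')) s @ \oo -->
    \sum_l U i' l * limn (pseries (exp_entry U l j') s).
  rewrite pseries_diffs_exp_entry; apply: pseries_lincomb => l.
  exact: is_cvg_exp_entry.
have -> : (U *m expmx (t *: U)) i j = limn (pseries (pseries_diffs (exp_entry U i j)) t).
  rewrite (cvg_lim _ (cd i j t)) // mxE.
  by apply: eq_bigr => l _; rewrite expmx_entry.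
apply: (@pseries_snd_diffs _ _ (`|t| + 1)).
- exact: is_cvg_exp_entry.
- by apply/cvg_ex; exists (\sum_l U i l * limn (pseries (exp_entry U l j) (`|t| + 1))).
- rewrite [X in pseries (pseries_diffs X)]pseries_diffs_exp_entry.
  rewrite (_ : pseries_diffs _ = fun m => \sum_l U i l * pseries_diffs (exp_entry U l j) m).
    apply/cvg_ex; eexists; apply: pseries_lincomb => l.
    by apply/cvg_ex; eexists; exact: cd.
  apply/funext => m; rewrite /pseries_diffs mulr_sumr.
  by apply: eq_bigr => l _; rewrite mulrCA.
- by rewrite [ltRHS]ger0_norm ?ltrDl // addr_ge0.
Qed.

Lemma is_derive_expmxM U z i (t : R) :
  is_derive t 1 (fun t : R => (expmx (t *: U) *m z) i 0)
    ((U *m (expmx (t *: U) *m z)) i 0).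
Proof.
have -> : (fun t : R => (expmx (t *: U) *m z) i 0) =
    \sum_(l < k) (fun t => z l 0 *: expmx (t *: U) i l).
  apply/funext => s; rewrite mxE fct_sumE; apply: eq_bigr => l _.
  by rewrite mulrC.
have -> : (U *m (expmx (t *: U) *m z)) i 0 =
    \sum_(l < k) z l 0 *: (U *m expmx (t *: U)) i l.
  by rewrite mulmxA mxE; apply: eq_bigr => l _; rewrite mulrC.
apply: is_derive_sum => l; apply: is_deriveZ; exact: is_derive_expmx.
Qed.

End MatrixExponential.

(** * The exponential integral *)

Lemma is_derive_sum_fun (R : realType) (n : nat) (F : 'I_n -> R -> R)
    (t : R) (dF : 'I_n -> R) :
  (forall i, is_derive t 1 (F i) (dF i)) ->
  is_derive t 1 (fun t => \sum_i F i t) (\sum_i dF i).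
Proof. by rewrite -fct_sumE; exact: is_derive_sum. Qed.

Section ExpInt.
Variables (R : realType) (a : R).
Implicit Types t : R.

(** The integral of [e^(a s)] from 0 to [t], in closed form so that it is
    differentiable on the whole line, negative times included. *)
Definition exp_int t : R := if a == 0 then t else (expR (a * t) - 1) / a.

Lemma exp_intE t : 1 + a * exp_int t = expR (a * t).
Proof.
rewrite /exp_int; case: eqP => [->|/eqP a0]; first by rewrite !mul0r expR0 addr0.
by rewrite mulrC divfK // addrC subrK.
Qed.

Lemma exp_int0 : exp_int 0 = 0.
Proof. by rewrite /exp_int mulr0 expR0 subrr mul0r if_same. Qed.

Lemma is_derive_exp_int t : is_derive t 1 exp_int (expR (a * t)).
Proof.
rewrite /exp_int; case: eqP => [->|/eqP a0]; first by rewrite mul0r expR0; exact: is_derive_id.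
have -> : (fun t => (expR (a * t) - 1) / a) = a^-1 *: ((expR \o ( *%R a)) - cst 1).
  by apply/funext => s; rewrite /= mulrC.
apply: is_derive_eq; rewrite /GRing.scale /= subr0; field.
by [].
Qed.

Lemma exp_int_le s t : s <= t -> exp_int s <= exp_int t.
Proof.
move=> st; have [] := @MVT_segment R exp_int (fun u => expR (a * u)) s t st.
- by move=> u _; exact: is_derive_exp_int.
- apply: derivable_within_continuous => u _; by have [] := is_derive_exp_int u.
move=> c _ /eqP; rewrite subr_eq => /eqP ->.
by rewrite lerDr mulr_ge0 ?expR_ge0 // subr_ge0.
Qed.

Lemma exp_int_ge0 t : 0 <= t -> 0 <= exp_int t.
Proof. by move=> t0; rewrite -exp_int0 exp_int_le. Qed.

Lemma Rintegral_expR t : 0 < t ->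
  (\int[lebesgue_measure]_(s in `[0%R, t]) expR (a * s))%R = exp_int t.
Proof.
move=> t0; rewrite /Rintegral.
rewrite (@continuous_FTC2 _ (fun s => expR (a * s)) exp_int) //.
- by rewrite exp_int0 -EFinB subr0.
- apply: derivable_within_continuous => s _.
  by apply: ex_derive; apply: (@is_derive1_comp _ expR ( *%R a)).
- split => [s _||].
  + by have [] := is_derive_exp_int s.
  + apply: cvg_at_right_filter; apply: differentiable_continuous.
    by apply/derivable1_diffP; have [] := is_derive_exp_int 0.
  + apply: cvg_at_left_filter; apply: differentiable_continuous.
    by apply/derivable1_diffP; have [] := is_derive_exp_int t.
- by move=> s _; rewrite derive1E; have [_ ->] := is_derive_exp_int s.
Qed.

End ExpInt.

(** * The chain of majorants *)

Section Chain.
Variables (R : realType) (a C M : R) (D Q : nat).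

(** Equations for majorants of the errors indexed by the number [k] of jumps
    made from degree 1.  No error of degree at most [D] has [D] jumps behind
    it, so the chain stops there; [Q] is the least number of jumps that can
    reach a truncated degree, and [M] is the source coming from these. *)
Definition chain_eq (b : nat -> R -> R) : Prop :=
  [/\ forall k t, (D <= k)%N -> b k t = 0, forall k, b k 0 = 0 &
      forall k (t : R), (k < D)%N -> is_derive t 1 (b k)
        (k.+1%:R * (a * b k t + C * (b k.+1 t + M * (Q <= k.+1)%:R)))].

(** The source is constant, so one more coordinate, equal to 1, makes the
    system linear and homogeneous, and the matrix exponential solves it. *)
Lemma chain_exists : exists b, chain_eq b.
Proof.
pose P : 'M[R]_D.+1 := \matrix_(i, l) (if (i < D)%N then
   i.+1%:R * (a * (l == i)%:R + C * (((l == i.+1 :> nat) && (l < D)%N)%:R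
      + M * (Q <= i.+1)%:R * (l == ord_max)%:R)) else 0).
pose s t := expmx (t *: P) *m (delta_mx ord_max 0 : 'cV[R]_D.+1).
have sd i (t : R) : is_derive t 1 (fun t : R => s t i 0) ((P *m s t) i 0).
  exact: is_derive_expmxM.
have s0 i : s 0 i 0 = (i == ord_max)%:R.
  by rewrite /s scale0r expmx0 mul1mx mxE eqxx andbT.
have sD t : s t ord_max 0 = 1.
  transitivity (s 0 ord_max 0); last by rewrite s0 eqxx.
  apply: (@is_derive_0_is_cst _ (fun t => s t ord_max 0)) => r.
  have -> : 0 = (P *m s r) ord_max 0; last exact: sd.
  by rewrite mxE big1 // => l _; rewrite mxE /= ltnn mul0r.
exists (fun k t => if (k < D)%N then s t (inord k) 0 else 0); split.
- by move=> k t; rewrite leqNgt => /negbTE ->.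
- move=> k; case: ltnP => // kD; rewrite s0; case: eqP => // /(congr1 val) /=.
  by rewrite inordK ?(leq_trans kD) // => e; rewrite e ltnn in kD.
move=> k t kD; rewrite kD; set k' := inord k.
have k'E : k' = k :> nat by rewrite inordK ?(leq_trans kD).
apply: is_derive_eq (sd k' t) _.
rewrite mxE.
under eq_bigr => l _ do rewrite mxE k'E kD -mulrA.
rewrite -mulr_sumr; congr (_ * _).
under eq_bigr => l _ do rewrite mulrDl -!mulrA mulrDl.
rewrite big_split /= -!mulr_sumr big_split /=; congr (_ * _ + C * (_ + _)).
- by rewrite (bigD1 k') //= eqxx mul1r big1 ?addr0 // => l /negbTE ->; rewrite mul0r.
- case: ltnP => kD1.
    have e : @inord D k.+1 = k.+1 :> nat by rewrite inordK // ltnW.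
    rewrite (bigD1 (inord k.+1)) //= e eqxx kD1 mul1r big1 ?addr0 // => l.
    by rewrite -val_eqE /= e => /negbTE ->; rewrite mul0r.
  rewrite big1 // => l _; case: eqP => [->|]; last by rewrite mul0r.
  by rewrite ltnNge kD1 mul0r.
- rewrite (bigD1 ord_max) //= eqxx sD !mulr1 big1 ?addr0 // => l /negbTE ->.
  by rewrite !(mul0r, mulr0).
Qed.

Hypotheses (C0 : 0 <= C) (M0 : 0 <= M).
Variables (b : nat -> R -> R) (bP : chain_eq b).

(** The off-diagonal coefficients and the source are nonnegative, so the
    maximum principle applies to [- b k]. *)
Lemma chain_ge0 k t : 0 <= t -> 0 <= b k t.
Proof.
move=> t0; have [kD|kD] := ltnP k D; last by have [-> //] := bP.
have [bD b0 bd] := bP.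
rewrite -oppr_le0.
pose u (i : 'I_D) (t : R) := - b i t.
pose du (i : 'I_D) (t : R) :=
  - (i.+1%:R * (a * b i t + C * (b i.+1 t + M * (Q <= i.+1)%:R))).
apply: (@max_principle R 'I_D xpredT u du t (D%:R * (`|a| + C))
          _ _ _ (Ordinal kD)) => //; last by rewrite t0 lexx.
- move=> i s _ _; exact: is_deriveN (bd i s (ltn_ord i)).
- by move=> i _; rewrite /u b0 oppr0.
move=> i s _ _; rewrite /u => bis bmax.
have bS : - b i.+1 s <= - b i s.
  have [iD|iD] := ltnP i.+1 D; first exact: (bmax (Ordinal iD)).
  by rewrite bD // oppr0 ltW.
have i0 : 0 <= i.+1%:R :> R by [].
have iD : i.+1%:R <= D%:R :> R by rewrite ler_nat.
have M1 : 0 <= M * (Q <= i.+1)%:R by rewrite mulr_ge0.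
have h1 : - (a * b i s + C * (b i.+1 s + M * (Q <= i.+1)%:R)) <=
    (`|a| + C) * - b i s.
  have h2 : a * - b i s <= `|a| * - b i s by rewrite ler_wpM2r ?ler_norm // ltW.
  have h3 : C * - b i.+1 s <= C * - b i s by rewrite ler_wpM2l.
  have h4 : 0 <= C * (M * (Q <= i.+1)%:R) by rewrite mulr_ge0.
  lra.
rewrite /du -mulrN (le_trans (ler_wpM2l i0 h1)) //.
rewrite -mulrA ler_wpM2r // mulr_ge0 ?addr_ge0 // ltW //.
Qed.

(** Duality: [e^(a s) (C exp_int s)^k] solves the adjoint chain.  Paired at time
    [t - r] with [b k r] and summed over [k], it changes only through the
    source, and so does the sum of the [(C exp_int (t - r))^(k+1)] with the
    opposite sign.  The constant sum of both is read off at [r = 0], where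
    [b] vanishes, and at [r = t], where only [b 0] remains. *)
Lemma chain_first t : (0 < D)%N -> (0 < Q)%N ->
  b 0%N t = M * \sum_(k < D) (Q <= k.+1)%:R * (C * exp_int a t) ^+ k.+1.
Proof.
move=> D0 Q0; have [bD b0 bd] := bP.
pose th r := exp_int a (t - r); pose e r := expR (a * (t - r)).
have thd (r : R) : is_derive r 1 th (- e r).
  rewrite (_ : th = exp_int a \o (fun r => t - r)) //.
  have := is_derive_exp_int a (t - r) => h.
  apply: is_derive_eq; rewrite /e; ring.
have ed (r : R) : is_derive r 1 e (- a * e r).
  rewrite (_ : e = expR \o (fun r => a * (t - r))) //.
  apply: is_derive_eq; rewrite /e /= /GRing.scale /=; ring.
have eE r : e r = 1 + a * th r by rewrite /e exp_intE.
pose S r := \sum_(k < D) (e r * (C * th r) ^+ k * b k r +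
  M * (Q <= k.+1)%:R * (C * th r) ^+ k.+1).
pose G (r : R) (k : nat) := k%:R * C * e r * (C * th r) ^+ k.-1 * b k r.
have Sd (r : R) : is_derive r (1 : R) S 0.
  (* G r k is the flow from step k to step k-1: the gains and the losses of
     neighbouring steps cancel. *)
  have -> : 0 = \sum_(k < D) (G r k.+1 - G r k).
    rewrite -(big_mkord xpredT (fun k => G r k.+1 - G r k)).
    by rewrite telescope_sumr // /G !mul0r bD ?mulr0 ?subr0.
  apply: is_derive_sum_fun => k.
  have yd : is_derive r 1 (fun r => C * th r) (C * - e r) := is_deriveZ C (thd r).
  have := is_deriveD
    (is_deriveM (is_deriveM (ed r) (is_deriveX k yd)) (bd k r (ltn_ord k)))
    (is_deriveZ (M * (Q <= k.+1)%:R) (is_deriveX k.+1 yd)).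
  set g := (X in is_derive _ _ X _) => gd.
  rewrite (_ : (fun s : R => _) = g); last by apply/funext => s; rewrite /g !fctE.
  apply: (is_derive_eq gd); rewrite /G !fctE /GRing.scale /=.
  rewrite eE; move: ((Q <= k.+1)%:R : R) => q.
  by clear g gd; case: k => -[|k] kD /=; rewrite ?exprS -?natr1; ring.
have := is_derive_0_is_cst 0 t Sd.
rewrite /S /e /th subrr mulr0 expR0 exp_int0 mulr0 subr0.
rewrite (eq_bigr (fun k : 'I_D =>
   M * ((Q <= k.+1)%:R * (C * exp_int a t) ^+ k.+1))) => [|k _]; last first.
  by rewrite b0 mulr0 add0r mulrA.
rewrite mulr_sumr => ->; rewrite -(prednK D0) big_ord_recl expr0 !mul1r.
rewrite big1 => [|k _]; last by rewrite !expr0n /= !(mul0r, mulr0) addr0.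
by rewrite expr0n /= mulr0 !addr0.
Qed.

End Chain.

(** * Vector fields and Lie derivatives *)

Section VectorField.
Variables (R : realType) (n : nat) (f : 'cV[mpoly n R]_n).
Implicit Types (u w : mpoly n R) (m g : multinom n).

Lemma LieD u w : Lie f (u + w) = Lie f u + Lie f w.
Proof.
by rewrite /Lie -big_split; apply: eq_bigr => j _; rewrite linearD mulrDl.
Qed.

Lemma LieZ c u : Lie f (c *: u) = c *: Lie f u.
Proof.
rewrite /Lie scaler_sumr; apply: eq_bigr => j _.
by rewrite linearZ -scalerAl.
Qed.

Lemma LieM u w : Lie f (u * w) = Lie f u * w + u * Lie f w.
Proof.
rewrite /Lie mulr_suml mulr_sumr -big_split; apply: eq_bigr => j _ /=.
by rewrite mderivM; ring.
Qed.

Lemma LieXU i : Lie f (mpolyX R (mnm1 i)) = f i 0.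
Proof.
rewrite /Lie (bigD1 i) //= big1 => [|j ji].
  rewrite mderivX mnm1E eqxx scale1r (_ : mnm_sub _ _ = mnm0) ?mpolyX0 ?mul1r ?addr0 //.
  by apply/mnmP => l; rewrite mnmBE mnm0E subnn.
by rewrite mderivX mnm1E eq_sym (negbTE ji) scale0r mul0r.
Qed.

(** Both sides are derivations of the polynomial ring, so it suffices to
    compare them on the coordinates, where this is the equation itself. *)
Lemma is_derive_meval (x : R -> 'cV[R]_n) (t : R) u :
  is_derive t 1 x (evalv (x t) f) ->
  is_derive t 1 (fun t => meval (fun i => x t i 0) u)
    (meval (fun i => x t i 0) (Lie f u)).
Proof.
move=> xd.
pose ev s : mpoly n R -> R := meval (fun i => x s i 0).
pose good u := is_derive t 1 (fun s => ev s u) (ev t (Lie f u)).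
have gD u1 u2 : good u1 -> good u2 -> good (u1 + u2).
  move=> d1 d2; rewrite /good.
  have -> : (fun s => ev s (u1 + u2)) = (fun s => ev s u1) + (fun s => ev s u2).
    by apply/funext => s; rewrite /ev mevalD.
  by rewrite LieD /ev mevalD; exact: is_deriveD.
have gZ c u1 : good u1 -> good (c *: u1).
  move=> d1; rewrite /good.
  have -> : (fun s => ev s (c *: u1)) = c *: (fun s => ev s u1).
    by apply/funext => s; rewrite /ev mevalZ.
  by rewrite LieZ /ev mevalZ; exact: is_deriveZ.
have gM u1 u2 : good u1 -> good u2 -> good (u1 * u2).
  move=> d1 d2; rewrite /good.
  have -> : (fun s => ev s (u1 * u2)) = (fun s => ev s u1) * (fun s => ev s u2).
    by apply/funext => s; rewrite /ev mevalM.
  rewrite LieM /ev mevalD !mevalM.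
  have /is_derive_eq := is_deriveM d1 d2; apply.
  by rewrite /GRing.scale /= addrC mulrC.
have g1 : good 1.
  rewrite /good; have -> : (fun s => ev s 1) = cst 1.
    by apply/funext => s; rewrite /ev meval1.
  have -> : Lie f 1 = 0; last by rewrite /ev meval0; exact: is_derive_cst.
  have := LieM 1 1; rewrite !(mul1r, mulr1) => /eqP.
  by rewrite -subr_eq subrr eq_sym => /eqP.
have gX i : good (mpolyX R (mnm1 i)).
  rewrite /good LieXU.
  have -> : (fun s => ev s (mpolyX R (mnm1 i))) = (fun s => x s i 0).
    by apply/funext => s; rewrite /ev mevalXU.
  have [dx xE] := xd; split; first exact: ((derivable_mxP x t 1).1 dx i 0).
  by have := congr1 (fun z : 'cV[R]_n => z i 0) xE; rewrite derive_mx // /evalv !mxE.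
have gX1 i k : good (mpolyX R (mnm1 i) ^+ k).
  by elim: k => [|k IH]; rewrite ?expr0 // exprS; apply: gM.
rewrite -/(good u) (mpolyE u).
elim/big_ind: _ => //; first by rewrite -(scale0r 1); apply: gZ.
by move=> m _; apply: gZ; rewrite mpolyXE_id; elim/big_ind: _.
Qed.

Lemma mu_oo_ge k (U : 'M[R]_k) i :
  U i i + \sum_(l < k | l != i) `|U i l| <= mu_oo U.
Proof.
rewrite /mu_oo; set F := fun i => _ + _.
apply: sup_upper_bound; last by exists i.
split; first by exists (F i), i.
exists (\sum_j `|F j|) => _ [j _ <-].
rewrite (le_trans (ler_norm _)) // (bigD1 j) //= lerDl.
by apply: sumr_ge0.
Qed.

Lemma C2_ge i :
  \sum_(g : bmultinom n (vdeg f).+1 | (2 <= mdeg g)%N) `|mcoeff g (f i 0)| <= C2 f.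
Proof. exact: (le_bigmax _ _ i). Qed.

Lemma C2_ge0 : 0 <= C2 f.
Proof. exact: bigmax_ge_id. Qed.

Lemma meval0E u : meval (fun=> 0) u = mcoeff mnm0 u.
Proof.
rewrite [in LHS](mpolyE u) [in RHS](mpolyE u) !raddf_sum.
apply: eq_bigr => k _ /=; rewrite mevalZ mcoeffZ mcoeffX mevalX; congr (_ * _).
have [->|kn] := eqVneq k mnm0; first by rewrite big1 // => i _; rewrite mnm0E expr0.
have /existsP[i ki] : [exists i, k i != 0%N].
  apply: contraR kn => /existsPn H; apply/eqP/mnmP => i.
  by apply/eqP; have := H i; rewrite negbK mnm0E.
by rewrite (bigD1 i) //= expr0n (negbTE ki) mul0r.
Qed.

Lemma field_linear_nonlinear j : evalv 0 f = 0 ->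
  f j 0 = \sum_l jacobian0 f j l *: mpolyX R (mnm1 l)
    + \sum_(g : bmultinom n (vdeg f).+1 | (2 <= mdeg g)%N)
        mcoeff g (f j 0) *: mpolyX R g.
Proof.
move=> f0; apply/mpolyP => m; rewrite mcoeffD !raddf_sum /=.
have jE l : jacobian0 f j l = mcoeff (mnm1 l) (f j 0).
  rewrite mxE meval0E mcoeff_deriv mnm0E mulr1n; congr mcoeff.
  by apply/mnmP => i; rewrite mnmDE mnm0E.
under eq_bigr => l _ do rewrite mcoeffZ mcoeffX jE.
under [X in _ + X]eq_bigr => g _ do rewrite mcoeffZ mcoeffX.
have [m2|m2] := ltnP 1 (mdeg m).
  rewrite big1 ?add0r => [|l _]; last first.
    case: eqP => [e|]; last by rewrite mulr0.
    by move: m2; rewrite -e mdeg1.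
  have [mD|mD] := ltnP (mdeg m) (vdeg f).+1.
    rewrite (bigD1 (BMultinom mD)) //= eqxx mulr1 big1 ?addr0 // => g /andP[_ gm].
    case: eqP => [e|]; last by rewrite mulr0.
    by move: gm; rewrite -val_eqE /= e eqxx.
  rewrite big1 => [|g _]; last first.
    case: eqP => [e|]; last by rewrite mulr0.
    by have := bmdeg g; rewrite e ltnNge mD.
  apply/eqP; rewrite mcoeff_eq0; apply: msize_mdeg_ge; apply: leq_trans mD.
  have : (tdeg (f j 0%R) <= vdeg f)%N.
    exact: (leq_bigmax (F := fun k => tdeg (f k 0)) j).
  by rewrite /tdeg; case: (mmeasure _ _).
rewrite [X in _ + X]big1 ?addr0 => [|g g2]; last first.
  case: eqP => [e|]; last by rewrite mulr0.
  by move: g2; rewrite e ltnNge m2.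
move: m2; rewrite leq_eqVlt ltnS leqn0 mdeg_eq0 => /orP[/mdeg1P[i /eqP ->]|/eqP ->].
  rewrite (bigD1 i) //= eqxx mulr1 big1 ?addr0 // => l li.
  case: eqP => [/mnmP /(_ l)|]; last by rewrite mulr0.
  by rewrite !mnm1E eqxx eq_sym (negbTE li).
rewrite big1 => [|l _]; last first.
  case: eqP => [/(congr1 (@mdeg n))|]; last by rewrite mulr0.
  by rewrite mdeg1 mdeg0.
rewrite -meval0E; have := congr1 (fun z : 'cV[R]_n => z j 0) f0.
rewrite /evalv !mxE => f0j; rewrite -[RHS]f0j.
by apply: meval_eq => i; rewrite mxE.
Qed.

(** The growth of one monomial, seen through any linear functional that is
    maximal on it among the monomials of its degree.  Each of the [mdeg m]
    factors of the monomial is differentiated in turn and replaced by a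
    component of the field.  The linear part keeps the degree, so the
    diagonal coefficient acts on the value [b] itself, with its sign, and
    the others on values at most [b]: this is the logarithmic norm.  The
    nonlinear part raises the degree. *)
Lemma functional_Lie_le (ell : mpoly n R -> R) m (b b' : R) :
  evalv 0 f = 0 ->
  linear_for *%R ell ->
  0 <= b -> 0 <= b' ->
  ell (mpolyX R m) = b ->
  (forall g, mdeg g = mdeg m -> `|ell (mpolyX R g)| <= b) ->
  (forall g, (mdeg m < mdeg g <= mdeg m + (vdeg f).-1)%N ->
     `|ell (mpolyX R g)| <= b') ->
  ell (Lie f (mpolyX R m)) <=
    (mdeg m)%:R * (mu_oo (jacobian0 f) * b + C2 f * b').
Proof.
move=> f0 ellL b0 b'0 mb gb gb'.
have ellD u w : ell (u + w) = ell u + ell w.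
  by have := ellL 1 u w; rewrite scale1r mul1r.
have ell0 : ell 0 = 0.
  by have := ellL (-1) 0 0; rewrite scaler0 addr0 mulN1r addNr.
have ellZ c u : ell (c *: u) = c * ell u.
  by have := ellL c u 0; rewrite !addr0 ell0 addr0.
have ellS (I : finType) (P : pred I) (F : I -> mpoly n R) :
    ell (\sum_(i | P i) F i) = \sum_(i | P i) ell (F i).
  by apply: big_morph.
rewrite /Lie ellS mdegE natr_sum mulr_suml; apply: ler_sum => j _.
rewrite mderivX -scalerAl ellZ.
have [->|mj] := posnP (m j); first by rewrite !mul0r.
rewrite ler_wpM2l //.
have dm : (mdeg (mnm_sub m (mnm1 j))).+1 = mdeg m.
  have {2}<- : mnm_add (mnm_sub m (mnm1 j)) (mnm1 j) = m.
    by rewrite submK // lep1mP -lt0n.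
  by rewrite mdegD mdeg1 addn1.
rewrite (field_linear_nonlinear j f0) mulrDr ellD !mulr_sumr !ellS.
apply: lerD.
  apply: (@le_trans _ _ ((jacobian0 f j j +
      \sum_(l < n | l != j) `|jacobian0 f j l|) * b)); last first.
    by rewrite ler_wpM2r // mu_oo_ge.
  rewrite (bigD1 j) //= mulrDl; apply: lerD.
    by rewrite -scalerAr ellZ -mpolyXD submK ?mb // lep1mP -lt0n.
  rewrite mulr_suml; apply: ler_sum => l lj.
  rewrite -scalerAr ellZ -mpolyXD (le_trans (ler_norm _)) // normrM.
  by rewrite ler_wpM2l // gb // mdegD mdeg1 addn1.
apply: (@le_trans _ _ ((\sum_(g : bmultinom n (vdeg f).+1 | (2 <= mdeg g)%N)
   `|mcoeff g (f j 0)|) * b')); last by rewrite ler_wpM2r // C2_ge.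
rewrite mulr_suml; apply: ler_sum => g g2.
rewrite -scalerAr ellZ -mpolyXD (le_trans (ler_norm _)) // normrM.
rewrite ler_wpM2l // gb' // mdegD.
by have := bmdeg g; move: g2 dm; lia.
Qed.

End VectorField.

(** * The truncation error *)

Section Error.
Variables (R : realType) (n : nat) (f : 'cV[mpoly n R]_n) (D : nat).
Implicit Types (u w : mpoly n R) (m g : multinom n) (i j : 'I_(nmon n 1 D)).

Let h := (vdeg f).-1.
Let mon i := nth mnm0 (monomials n 1 D) i.

Lemma mdeg_mon i : (1 <= mdeg (mon i) <= D)%N.
Proof. by rewrite -mem_monomials mem_nth. Qed.

Lemma mon_surj m : (1 <= mdeg m <= D)%N -> exists i, mon i = m.
Proof.
rewrite -mem_monomials => mD.
have lt_m : (index m (monomials n 1 D) < nmon n 1 D)%N by rewrite index_mem.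
by exists (Ordinal lt_m); rewrite /mon /= nth_index.
Qed.

Lemma mon_inj : injective mon.
Proof.
move=> i j /eqP; rewrite /mon nth_uniq ?uniq_monomials // => /eqP e.
exact: val_inj.
Qed.

(** The values of the Carleman variables, extended linearly to all polynomials
    by 0 on the truncated monomials. *)
Definition trunc_eval (z : 'cV[R]_(nmon n 1 D)) u : R :=
  \sum_i mcoeff (mon i) u * z i 0.

Lemma trunc_evalX z i : trunc_eval z (mpolyX R (mon i)) = z i 0.
Proof.
rewrite /trunc_eval (bigD1 i) //= mcoeffX eqxx mul1r big1 ?addr0 // => j ji.
by rewrite mcoeffX (inj_eq mon_inj) eq_sym (negbTE ji) mul0r.
Qed.

Lemma trunc_eval_gt z m : (D < mdeg m)%N -> trunc_eval z (mpolyX R m) = 0.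
Proof.
move=> Dm; rewrite /trunc_eval big1 // => j _; rewrite mcoeffX.
case: eqP => [e|]; last by rewrite mul0r.
by have := mdeg_mon j; rewrite -e [X in _ && X]leqNgt Dm andbF.
Qed.

Variables (A : 'M[R]_(nmon n 1 D)) (B : 'M[R]_(nmon n 1 D, nmon n D.+1 (D + h))).
Hypothesis AB : carleman_matrices A B.

(** The matrix of the truncated system is the Lie derivative followed by the
    truncation, so the Carleman variables and the exact monomials obey the same
    equation: the derivative of [err] at [x^m] is [err] at the Lie derivative
    of [x^m]. *)
Lemma carleman_trunc_eval z i :
  (A *m z) i 0 = trunc_eval z (Lie f (mpolyX R (mon i))).
Proof.
rewrite mxE; apply: eq_bigr => j _; congr (_ * _).
have := congr1 (fun M : 'cV[mpoly n R]_(nmon n 1 D) => mcoeff (mon j) (M i 0)) AB.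
rewrite [in X in X -> _]mxE /alpha mxE => ->.
rewrite mxE mcoeffD combE_coef combE_out ?addr0 //.
by rewrite mem_monomials; have := mdeg_mon j; lia.
Qed.

Variables (x : R -> 'cV[R]_n) (x0 : 'cV[R]_n).

Definition err (t : R) u : R :=
  meval (fun l => x t l 0) u - trunc_eval (zD A x0 t) u.

Lemma err_linear t : linear_for *%R (err t).
Proof.
move=> c u w; rewrite /err mevalD mevalZ.
have -> : trunc_eval (zD A x0 t) (c *: u + w) =
    c * trunc_eval (zD A x0 t) u + trunc_eval (zD A x0 t) w.
  rewrite /trunc_eval mulr_sumr -big_split; apply: eq_bigr => i _ /=.
  by rewrite mcoeffD mcoeffZ; ring.
ring.
Qed.

Lemma err0 i : x 0 = x0 -> err 0 (mpolyX R (mon i)) = 0.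
Proof.
move=> x00; rewrite /err trunc_evalX /zD scale0r expmx0 mul1mx /evalv /alpha.
by rewrite !mxE x00 subrr.
Qed.

Lemma is_derive_err (t : R) i : is_derive t 1 x (evalv (x t) f) ->
  is_derive t 1 (fun t => err t (mpolyX R (mon i)))
    (err t (Lie f (mpolyX R (mon i)))).
Proof.
move=> /(is_derive_meval (mpolyX R (mon i))) xd.
rewrite /err -carleman_trunc_eval.
have -> : (fun t => meval (fun l => x t l 0) (mpolyX R (mon i)) -
      trunc_eval (zD A x0 t) (mpolyX R (mon i))) =
    (fun t => meval (fun l => x t l 0) (mpolyX R (mon i))) -
    (fun t => zD A x0 t i 0).
  by apply/funext => s; rewrite trunc_evalX.
by apply: is_deriveB; exact: is_derive_expmxM.
Qed.

Definition growth : R :=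
  Num.min (mu_oo (jacobian0 f)) 0 + h%:R * Num.max (mu_oo (jacobian0 f)) 0.

(** For a negative [mu_1] the lower bound [k < d] matters, for a positive one
    the upper bound on [d]; [growth] serves both. *)
Lemma growth_ge k d : (0 < h)%N -> (k < d)%N -> (d <= 1 + k * h)%N ->
  d%:R * mu_oo (jacobian0 f) <= k.+1%:R * growth.
Proof.
move=> h0 kd dk; rewrite /growth; set mu := mu_oo _.
have [mu0|mu0] := leP mu 0.
  by rewrite mulr0 addr0 ler_wnM2r // ler_nat.
rewrite add0r mulrA -natrM ler_wpM2r ?ler_nat //; first exact: ltW.
by move: h0 dk; rewrite mulSn; lia.
Qed.

(** The maximum principle is applied to the functions [+- err - b k] over all
    signs, all monomials and all [k] compatible with the degree.  A jump leads
    from a pair (monomial, [k]) to pairs with [k+1] only, again compatible,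
    unless the degree exceeds [D]; then [M] bounds the monomial. *)
Lemma err_le_chain (T M : R) (Q : nat) (b : nat -> R -> R) :
  evalv 0 f = 0 ->
  (0 < h)%N ->
  0 <= M ->
  x 0 = x0 ->
  (forall t, 0 <= t <= T -> is_derive t 1 x (evalv (x t) f)) ->
  (forall t m, 0 <= t <= T -> (D < mdeg m <= D + h)%N ->
     `|meval (fun l => x t l 0) (mpolyX R m)| <= M) ->
  (forall k, (D <= k.+1 * h)%N -> (Q <= k.+1)%N) ->
  chain_eq growth (h%:R * C2 f) M D Q b ->
  forall t i k, 0 <= t <= T -> (k < mdeg (mon i))%N -> (mdeg (mon i) <= 1 + k * h)%N ->
    `|err t (mpolyX R (mon i))| <= b k t.
Proof.
move=> f0 h0 M0 x00 xd xM QP bP.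
set C := h%:R * C2 f; have C20 : 0 <= C2 f := C2_ge0 f.
have C0 : 0 <= C by rewrite mulr_ge0.
have b0 k t : 0 <= t -> 0 <= b k t by move=> t0; exact: (chain_ge0 C0 M0 bP).
have [bD bI bd] := bP.
pose I := (bool * 'I_(nmon n 1 D) * 'I_D)%type.
pose P : pred I := fun q =>
  (q.2 < mdeg (mon q.1.2))%N && (mdeg (mon q.1.2) <= 1 + q.2 * h)%N.
pose sg (s : bool) : R := (-1) ^+ s.
pose E (q : I) t (u : mpoly n R) := sg q.1.1 * err t u.
pose u (q : I) t := E q t (mpolyX R (mon q.1.2)) - b q.2 t.
pose du (q : I) t := E q t (Lie f (mpolyX R (mon q.1.2))) -
  (q.2.+1%:R * (growth * b q.2 t + C * (b q.2.+1 t + M * (Q <= q.2.+1)%:R))).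
have key : forall q t, P q -> 0 <= t <= T -> u q t <= 0.
  apply: (@max_principle _ I P u du T (D%:R * (`|growth| + C))).
  - move=> q t Pq tT.
    have -> : u q = sg q.1.1 *: (fun t => err t (mpolyX R (mon q.1.2))) - b q.2.
      by [].
    apply: is_deriveB; last exact: bd.
    by apply: is_deriveZ; apply: is_derive_err; exact: xd.
  - by move=> q Pq; rewrite /u /E err0 // mulr0 bI subrr.
  move=> [[s i] k] t /andP[/= kd dk] tT; set dl := u _ t => dl0 umax.
  have t0 : 0 <= t by case/andP: tT.
  have EP (j : 'I_(nmon n 1 D)) (l : 'I_D) :
      (l < mdeg (mon j))%N -> (mdeg (mon j) <= 1 + l * h)%N ->
      `|err t (mpolyX R (mon j))| <= b l t + dl.
    move=> ld dld; rewrite ler_norml lerNl.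
    have := umax (true, j, l); have := umax (false, j, l).
    rewrite /P /= ld dld /u /E /sg /= expr0 expr1 => /(_ isT) + /(_ isT); lra.
  (* Where the family is maximal, the errors of the same degree are at most w
     and those reached by one jump at most w'. *)
  set w := b k t + dl; set w' := b k.+1 t + M * (Q <= k.+1)%:R + dl.
  have M1 : 0 <= M * (Q <= k.+1)%:R by rewrite mulr_ge0.
  have w0 : 0 <= w by rewrite addr_ge0 ?b0 // ltW.
  have w'0 : 0 <= w' by rewrite (addr_ge0 (addr_ge0 (b0 _ _ t0) M1) (ltW dl0)).
  have sgE y : `|sg s * y| = `|y| by rewrite normrM normrX normrN1 expr1n mul1r.
  have Elin : linear_for *%R (E (s, i, k) t).
    by move=> c y1 y2; rewrite /E err_linear mulrDr mulrCA.
  have := @functional_Lie_le R n f (E (s, i, k) t) (mon i) w w' f0 Elin w0 w'0.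
  have -> : E (s, i, k) t (mpolyX R (mon i)) = w by rewrite /w /dl /u /= addrC subrK.
  move=> /(_ erefl) H.
  have {H}: E (s, i, k) t (Lie f (mpolyX R (mon i))) <=
      (mdeg (mon i))%:R * (mu_oo (jacobian0 f) * w + C2 f * w').
    apply: H => g.
      move=> gd; have [|j jE] := @mon_surj g; first by rewrite gd mdeg_mon.
      by rewrite sgE -jE EP // jE gd.
    move=> /andP[dg gd]; rewrite sgE.
    have gk : (mdeg g <= 1 + k.+1 * h)%N.
      by rewrite (leq_trans gd) // mulSn addnCA addnC leq_add2l.
    have [gD|gD] := leqP (mdeg g) D.
      have kD : (k.+1 < D)%N by apply: leq_trans gD; apply: leq_trans dg.
      have [|j jE] := @mon_surj g; first by rewrite gD (leq_trans _ dg).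
      rewrite -jE (le_trans (EP j (Ordinal kD) _ _)) ?jE //=.
        exact: leq_trans dg.
      by rewrite /w' lerD2r lerDl.
    have Qk : (Q <= k.+1)%N by apply: QP; move: gD gk; lia.
    rewrite /err trunc_eval_gt // subr0 (le_trans (xM t g tT _)) //.
      rewrite gD /=; have := mdeg_mon i; move: gd; rewrite -/h; lia.
    by rewrite /w' Qk mulr1 addrAC lerDr addr_ge0 ?b0 // ltW.
  have d1 := growth_ge h0 kd dk.
  have d2 : (mdeg (mon i))%:R * C2 f <= k.+1%:R * C.
    rewrite /C mulrA -natrM ler_wpM2r // ler_nat.
    move: dk h0; rewrite mulSn addnC; lia.
  move=> H; rewrite /du.
  have {d1 d2}{}H : E (s, i, k) t (Lie f (mpolyX R (mon i))) <=
      k.+1%:R * (growth * w + C * w').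
    apply: (le_trans H); rewrite [leLHS]mulrDr [leRHS]mulrDr; apply: lerD.
      by rewrite [leLHS]mulrA [leRHS]mulrA; apply: ler_wpM2r.
    by rewrite [leLHS]mulrA [leRHS]mulrA; apply: ler_wpM2r.
  apply: (@le_trans _ _ (k.+1%:R * ((`|growth| + C) * dl))); last first.
    rewrite -mulrA; apply: ler_wpM2r; last by rewrite ler_nat.
    by apply: mulr_ge0 (ltW dl0); apply: addr_ge0.
  rewrite /= lerBlDr -mulrDr; apply: (le_trans H); rewrite ler_wpM2l //.
  have : growth * dl <= `|growth| * dl by rewrite ler_wpM2r ?ler_norm // ltW.
  rewrite /w /w'; lra.
move=> t i k tT ki ik.
have kD : (k < D)%N by apply: leq_trans ki _; case/andP: (mdeg_mon i).
have := key (true, i, Ordinal kD) t; have := key (false, i, Ordinal kD) t.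
rewrite /P /= ki ik /u /E /sg /= expr0 expr1 => /(_ isT tT) + /(_ isT tT).
rewrite ler_norml; lra.
Qed.

End Error.

(** * The error bound *)

Section Observables.
Variables (R : realType) (n D : nat).
Implicit Types w : 'cV[R]_(nmon n 1 D).

Lemma supported_deg1P w j : supported_deg1 w -> w j 0 != 0 ->
  mdeg (nth mnm0 (monomials n 1 D) j) = 1%N.
Proof.
move=> ws /ws; rewrite /tdeg /alpha mxE.
by rewrite mmeasureX.
Qed.

(** The linear form determines the norm of its coefficients; hence the norm is
    the same for all truncation degrees. *)
Lemma norm1_observable w : (1 <= D)%N -> supported_deg1 w ->
  norm1 w = \sum_(i < n) `|observable w (delta_mx i 0)|.
Proof.
move=> D1 ws.
have idx_ex (i : 'I_n) : exists j : 'I_(nmon n 1 D),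
    nth mnm0 (monomials n 1 D) j = mnm1 i.
  by apply: mon_surj; rewrite mdeg1 D1.
have [idx idxE] := choice idx_ex.
have obsE i : observable w (delta_mx i 0) = w (idx i) 0.
  rewrite /observable mxE (bigD1 (idx i)) //= !mxE idxE mevalXU mxE !eqxx mulr1.
  rewrite big1 ?addr0 // => j ji; rewrite !mxE.
  have [->|wj] := eqVneq (w j 0) 0; first by rewrite mul0r.
  have /eqP/mdeg1P[l /eqP lE] := supported_deg1P ws wj.
  rewrite lE mevalXU mxE eqxx andbT; case: eqP => [e|]; last by rewrite mulr0.
  by case/eqP: ji; apply: mon_inj; rewrite lE idxE e.
under [RHS]eq_bigr do rewrite obsE.
have idx_inj : injective idx.
  move=> i l /(congr1 (fun j : 'I_(nmon n 1 D) => nth mnm0 (monomials n 1 D) j)).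
  rewrite !idxE => /mnmP/(_ i); rewrite !mnm1E eqxx.
  by case: eqP.
rewrite /norm1 (bigID (mem (imset idx (mem 'I_n)))) /= [X in _ + X]big1 ?addr0 => [|j jN].
  by rewrite big_imset //= => ? ? _ _; exact: idx_inj.
apply/eqP; rewrite normr_eq0; apply: contraNT jN => wj.
have /eqP/mdeg1P[l /eqP lE] := supported_deg1P ws wj.
by apply/imsetP; exists l => //; apply: mon_inj; rewrite lE idxE.
Qed.

End Observables.

Lemma meval_mpolyX_le (R : realType) (n : nat) (y : 'I_n -> R) (r : R) m :
  (forall i, `|y i| <= r) -> `|meval y (mpolyX R m)| <= r ^+ mdeg m.
Proof.
move=> yr; rewrite mevalX normr_prod mdegE -prodrXr.
by apply: ler_prod => i _; rewrite normrX exprn_ge0 //= lerXn2r // nnegrE (le_trans _ (yr i)).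
Qed.

Lemma geometric_tail_le (R : realType) (r : R) (Q N : nat) : 0 <= r -> r < 1 ->
  \sum_(k < N) (Q <= k.+1)%:R * r ^+ k.+1 <= r ^+ Q / (1 - r).
Proof.
move=> r0 r1; have r1' : 0 < 1 - r by rewrite subr_gt0.
rewrite ler_pdivlMr //.
(* Multiplied by 1 - r the sum telescopes, from its first term at k + 1 = Q. *)
suff : (\sum_(k < N) (Q <= k.+1)%:R * r ^+ k.+1) * (1 - r) <=
    if (N < Q)%N then 0 else r ^+ Q - r ^+ N.+1.
  case: ifP => _ /le_trans; apply; first exact: exprn_ge0.
  by rewrite lerBlDr lerDl exprn_ge0.
elim: N => [|N IH].
  rewrite big_ord0 mul0r; case: ltnP => //.
  by rewrite leqn0 => /eqP ->; rewrite expr0 expr1 ltW.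
rewrite big_ord_recr /= mulrDl.
case: (ltngtP N.+1 Q) => NQ.
- by rewrite ltnW // in IH; rewrite mul0r mul0r addr0.
- rewrite ltnNge -ltnS NQ /= in IH.
  by rewrite (le_trans (lerD IH (lexx _))) // mul1r (exprS r N.+1); lra.
- rewrite -NQ ltnSn in IH.
  by rewrite -NQ mul1r (le_trans (lerD IH (lexx _))) // add0r (exprS r N.+1); lra.
Qed.

Lemma kgapE (R : realType) (h D : nat) : (0 < h)%N -> (0 < D)%N ->
  kgap R h D = (D.-1 %/ h)%N.
Proof.
move=> h0 D0; rewrite /kgap.
have hR : 0 < h%:R :> R by rewrite ltr0n.
set q := (D.-1 %/ h)%N.
have qD : (q * h < D)%N by have := leq_divM D.-1 h; rewrite -/q; lia.
have Dq : (D <= q.+1 * h)%N by have := ltn_ceil D.-1 h0; rewrite -/q; lia.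
apply: ceil_def; apply/andP; split.
  rewrite ltr_pdivlMr // ltrBrDr -[X in _ < X]/(D%:R).
  rewrite intrB mulrBl mul1r subrK.
  by rewrite -natrM ltr_nat.
rewrite ler_pdivrMr // lerBlDr -[X in _ + X]mul1r -mulrDl.
by rewrite -[X in _ <= (X + _) * _]/(q%:R) natr1 -natrM ler_nat.
Qed.

Section Bound.
Variables (R : realType) (n : nat) (f : 'cV[mpoly n R]_n).
Variables (x0 : 'cV[R]_n) (T Rb : R) (J : set R) (x : R -> 'cV[R]_n) (D : nat).
Variables (A : 'M[R]_(nmon n 1 D)).
Variables (B : 'M[R]_(nmon n 1 D, nmon n D.+1 (D + (vdeg f).-1))).
Variables (v : 'cV[R]_(nmon n 1 D)).
Let h := (vdeg f).-1.
Let k := (D.-1 %/ h)%N.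

Hypotheses (h0 : (0 < h)%N) (f0 : evalv 0 f = 0) (T0 : 0 < T) (D0 : (0 < D)%N).
Hypotheses (xS : is_solution f x0 J x) (TJ : `[0, T] `<=` J).
Hypothesis xR : forall t, 0 <= t <= T -> `|x t| <= Rb.
Hypotheses (AB : carleman_matrices A B) (vS : supported_deg1 v) (r1 : rho f T < 1).

Lemma rhoE : rho f T = h%:R * C2 f * exp_int (growth f) T.
Proof. by rewrite /rho /Theta Rintegral_expR. Qed.

Lemma rho_ge0 : 0 <= rho f T.
Proof. by rewrite rhoE !mulr_ge0 ?C2_ge0 // exp_int_ge0 // ltW. Qed.

Lemma Rb_ge0 : 0 <= Rb.
Proof. by apply: le_trans (normr_ge0 _) (@xR 0 _); rewrite lexx ltW. Qed.

(** From [h k < D <= h (k+1)] the exponent is [h k + 2] plus at most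
    [2 h - 2]; on this excess [Rb] may be smaller than 1, so it is replaced by
    its maximum with 1. *)
Lemma pow_window_le d : (D < d <= D + h)%N ->
  Rb ^+ d <= Rb ^+ (h * k + 2) * Num.max Rb 1 ^+ (2 * h - 2).
Proof.
have kD : (k * h <= D.-1)%N := leq_divM D.-1 h.
have Dk : (D.-1 < k.+1 * h)%N := ltn_ceil D.-1 h0.
rewrite mulSn in Dk => dD.
have -> : (d = (h * k + 2) + (d - (h * k + 2)))%N by rewrite mulnC; lia.
rewrite exprD ler_wpM2l ?exprn_ge0 ?Rb_ge0 //.
apply: (@le_trans _ _ (Num.max Rb 1 ^+ (d - (h * k + 2)))).
  by rewrite lerXn2r ?nnegrE ?le_max ?Rb_ge0 ?lexx ?ler01 ?orbT.
by rewrite ler_weXn2l ?le_max ?lexx ?orbT // mulnC; lia.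
Qed.

Lemma eps_le t : 0 <= t <= T ->
  eps A v x x0 t <= norm1 v * rho f T * Rb ^+ 2 *
     Num.max Rb 1 ^+ (2 * h - 2) / (1 - rho f T) * (Rb ^+ h * rho f T) ^+ k.
Proof.
move=> tT; have [Jo _ J0 x00 xd] := xS.
set M := Rb ^+ (h * k + 2) * Num.max Rb 1 ^+ (2 * h - 2).
have M0 : 0 <= M by rewrite mulr_ge0 ?exprn_ge0 ?Rb_ge0 // le_max ler01 orbT.
have [b bP] := chain_exists (growth f) (h%:R * C2 f) M D k.+1.
have xd' s : 0 <= s <= T -> is_derive s 1 x (evalv (x s) f).
  by move=> sT; apply: xd; apply: TJ; rewrite /= in_itv.
have xM s m : 0 <= s <= T -> (D < mdeg m <= D + h)%N ->
    `|meval (fun l => x s l 0) (mpolyX R m)| <= M.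
  move=> sT mD; apply: le_trans (pow_window_le mD); apply: meval_mpolyX_le => i.
  apply: le_trans (xR sT).
  by rewrite [leRHS]/Num.Def.normr /= mx_normrE; exact: (le_bigmax _ _ (i, 0)).
have kQ l : (D <= l.+1 * h)%N -> (k < l.+1)%N.
  by move=> Dl; rewrite /k ltn_divLR //; lia.
have main := err_le_chain AB f0 h0 M0 x00 xd' xM kQ bP.
have b0 : b 0%N t <= M * (rho f T ^+ k.+1 / (1 - rho f T)).
  have C0 : 0 <= h%:R * C2 f by rewrite mulr_ge0 ?C2_ge0.
  rewrite (chain_first bP) // ler_wpM2l //.
  apply: le_trans (geometric_tail_le k.+1 D rho_ge0 r1).
  case/andP: tT => t0 tT.
  apply: ler_sum => l _; rewrite ler_wpM2l // lerXn2r ?nnegrE ?rho_ge0 //.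
    by rewrite mulr_ge0 ?exp_int_ge0.
  by rewrite rhoE ler_wpM2l // exp_int_le.
have -> : norm1 v * rho f T * Rb ^+ 2 * Num.max Rb 1 ^+ (2 * h - 2) /
    (1 - rho f T) * (Rb ^+ h * rho f T) ^+ k =
    norm1 v * (M * (rho f T ^+ k.+1 / (1 - rho f T))).
  rewrite /M exprMn -exprM exprD [rho f T ^+ k.+1]exprS.
  move: (Rb ^+ (h * k)) (Rb ^+ 2) (Num.max Rb 1 ^+ _) (rho f T ^+ k).
  move: (1 - rho f T)^-1 (rho f T) (norm1 v) => c1 c2 c3 c4 c5 c6 c7; ring.
apply: (@le_trans _ _ (norm1 v * b 0%N t)); last first.
  by rewrite ler_wpM2l // sumr_ge0.
have -> : eps A v x x0 t = `|\sum_j v j 0 *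
    err A x x0 t (mpolyX R (nth mnm0 (monomials n 1 D) j))|.
  rewrite /eps /observable !mxE -sumrB; congr `|_|; apply: eq_bigr => j _.
  by rewrite /err trunc_evalX !mxE mulrBr.
rewrite (le_trans (ler_norm_sum _ _ _)) // /norm1 mulr_suml; apply: ler_sum => j _.
rewrite normrM; have [->|vj] := eqVneq (v j 0) 0; first by rewrite normr0 !mul0r.
rewrite ler_wpM2l //.
by apply: (main t j 0%N tT); rewrite (supported_deg1P vS vj) ?mul0n.
Qed.

End Bound.

Theorem corollary1 (R : realType) (n : nat) (f : 'cV[mpoly n R]_n)
  (x0 : 'cV[R]_n) (T Rb : R) (J : set R) (x : R -> 'cV[R]_n)
  (A : forall D : nat, 'M[R]_(nmon n 1 D))
  (B : forall D : nat, 'M[R]_(nmon n 1 D, nmon n D.+1 (D + (vdeg f).-1)))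
  (v : forall D : nat, 'cV[R]_(nmon n 1 D)) :
  let h := (vdeg f).-1 in
  let Rplus := Num.max Rb 1 in
  let gamma1 := Rb ^+ h * rho f T in
  let K1 := norm1 (v 1%N) * rho f T * Rb ^+ 2 * Rplus ^+ (2 * h - 2)
            / (1 - rho f T) in
  let sup_eps D := ereal_sup [set (eps (A D) (v D) x x0 t)%:E | t in `[0, T]] in
  (2 <= vdeg f)%N ->
  evalv 0 f = 0 ->
  0 < T ->
  is_solution f x0 J x ->
  `[0, T] `<=` J ->
  (ereal_sup [set (`|x t|)%:E | t in `[0%R, T]] <= Rb%:E)%E ->
  (forall D, (1 <= D)%N -> carleman_matrices (A D) (B D)) ->
  (forall D, (1 <= D)%N -> supported_deg1 (v D)) ->
  (forall D D' y, (1 <= D)%N -> (1 <= D')%N ->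
    observable (v D) y = observable (v D') y) ->
  rho f T < 1 ->
  (forall D, (1 <= D)%N ->
    (sup_eps D <= (K1 * gamma1 ^ kgap R h D)%:E)%E) /\
  (gamma1 < 1 -> sup_eps D @[D --> \oo] --> 0%E).
Proof.
move=> h Rplus gamma1 K1 sup_eps f2 f0 T0 xS TJ xR AB vS vobs r1.
have h0 : (0 < h)%N by rewrite /h; move: f2; case: (vdeg f) => [|[]].
have xR' t : 0 <= t <= T -> `|x t| <= Rb.
  move=> tT; rewrite -lee_fin; apply: le_trans xR; apply: ereal_sup_ubound.
  by exists t; rewrite //= in_itv.
have bound D : (1 <= D)%N -> (sup_eps D <= (K1 * gamma1 ^ kgap R h D)%:E)%E.
  move=> D1; apply: ub_ereal_sup => _ [t /= + <-]; rewrite in_itv /= => tT.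
  rewrite lee_fin kgapE // -exprnP.
  have := eps_le h0 f0 T0 D1 xS TJ xR' (AB D D1) (vS D D1) r1 tT.
  suff -> : norm1 (v D) = norm1 (v 1%N) by [].
  rewrite !norm1_observable //; last by apply: vS.
    by apply: eq_bigr => i _; rewrite (vobs D 1%N).
  exact: vS.
split=> // g1.
have g0 : 0 <= gamma1 by rewrite mulr_ge0 ?exprn_ge0 ?(Rb_ge0 T0 xR') ?(rho_ge0 f T0).
have lim0 : (K1 * gamma1 ^+ (D.-1 %/ h)) @[D --> \oo] --> (0 : R).
  rewrite -(mulr0 K1); apply: cvgMl_tmp.
  have : gamma1 ^+ k @[k --> \oo] --> (0 : R) by apply: cvg_expr; rewrite ger0_norm.
  apply: cvg_comp => P [N _ NP]; exists (N * h).+1 => // D /= ND.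
  by apply: NP => /=; rewrite leq_divRL //; case: D ND.
apply: (@squeeze_cvge _ _ _ _ (fun=> 0%E) _ (fun D => (K1 * gamma1 ^+ (D.-1 %/ h))%:E)).
- near=> D.
  have D1 : (1 <= D)%N by near: D; exists 1%N.
  apply/andP; split; last by have := bound D D1; rewrite kgapE.
  apply: (@le_trans _ _ (eps (A D) (v D) x x0 0)%:E); first by rewrite lee_fin normr_ge0.
  apply: ereal_sup_ubound; exists 0; last by [].
  by rewrite /= in_itv /= lexx; exact: ltW.
- exact: cvg_cst.
- by apply: cvg_EFin lim0; exact: nearW.
Unshelve. all: by end_near. Qed.
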